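(* Let $X$ be a Hadamard space with linear dual space $X^{\lozenge}$ and let $p\in X$. Let $T:X\multimap X^{\lozenge}$ be a maximal monotone operator such that $X\times\mathrm{Range}(T)$ has the $\mathcal F_l$-property. Then there exists a unique $h\in\Gamma_p^{\lozenge}(X)$ for which $T=S_{h,p}$, where $S_{h,p}(x):=\{x^{\lozenge}\in X^{\lozenge}:h(x,x^{\lozenge})=\pi_p(x,x^{\lozenge})\}$ for $x\in X$.
   Context: A Hadamard space is a (nonempty) complete $\mathrm{CAT}(0)$ space $(X,d)$. For $x,y\in X$ and $t\in[0,1]$, $(1-t)x\oplus ty$ denotes the point $c(t)$ of the unique constant-speed geodesic $c:[0,1]\to X$ from $x$ to $y$. Quasilinearization: for $x,y,u,v\in X$, $\langle\overrightarrow{xy},\overrightarrow{uv}\rangle:=\frac12\big(d(x,v)^2+d(y,u)^2-d(x,u)^2-d(y,v)^2\big)$. Dual spaces: for $t\in\mathbb R$, $a,b\in X$, $[t\overrightarrow{ab}]$ is the class of $(t,a,b)\in\mathbb R\times X^2$ under the relation $(t,a,b)\sim(s,c,d)$ iff $t\langle\overrightarrow{ab},\overrightarrow{xy}\rangle=s\langle\overrightarrow{cd},\overrightarrow{xy}\rangle$ for all $x,y\in X$; it is identified with the function $\overrightarrow{xy}\mapsto t\langle\overrightarrow{ab},\overrightarrow{xy}\rangle$ on $X^2$. $X^*$ is the set of all such classes, and the linear dual $X^{\lozenge}$ is the real vector space of all finite linear combinations $\sum_i\alpha_i x_i^*$ ($\alpha_i\in\mathbb R$, $x_i^*\in X^*$),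 acting on $X^2$ by $\langle\sum_i\alpha_ix_i^*,\overrightarrow{xy}\rangle=\sum_i\alpha_i\langle x_i^*,\overrightarrow{xy}\rangle$ (elements with the same action are equal). $X^{\lozenge}$ carries the norm $\|x^{\lozenge}\|_{\lozenge}=\sup\Big\{\frac{|\langle x^{\lozenge},\overrightarrow{ab}\rangle-\langle x^{\lozenge},\overrightarrow{cd}\rangle|}{d(a,b)+d(c,d)}: a,b,c,d\in X,\ (a,c)\ne(b,d)\Big\}$, and $X\times X^{\lozenge}$ the product topology. For $M\subseteq X\times X^{\lozenge}$, $\mathrm{Dom}(M)$ and $\mathrm{Range}(M)$ are the projections of $M$ to $X$ and $X^{\lozenge}$. $M$ has the $\mathcal F_l$-property if $\langle x^{\lozenge},\overrightarrow{p((1-\lambda)x\oplus\lambda y)}\rangle\le(1-\lambda)\langle x^{\lozenge},\overrightarrow{px}\rangle+\lambda\langle x^{\lozenge},\overrightarrow{py}\rangle$ for all $\lambda\in[0,1]$, $x^{\lozenge}\in\mathrm{Range}(M)$, $x,y\in\mathrm{Dom}(M)$ (this does not depend on the choice of $p\in X$). For $h:X\times X^{\lozenge}\to[-\infty,\infty]$: $h$ is proper if it never takes the value $-\infty$ and $h\not\equiv\infty$; l.s.c. if its epigraph is closed; convex if $h((1-\lambda)x\oplus\lambda y,(1-\lambda)x^{\lozenge}+\lambda y^{\lozenge})\le(1-\lambda)h(x,x^{\lozenge})+\lambda h(y,y^{\lozenge})$ for all $(x,x^{\lozenge}),(y,y^{\lozenge})$ and $\lambda\in[0,1]$. $\Gamma(X\times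 X^{\lozenge})$ is the set of proper, l.s.c., convex $h:X\times X^{\lozenge}\to[-\infty,\infty]$. Fix $p\in X$. $\pi_p(x,x^{\lozenge}):=\langle x^{\lozenge},\overrightarrow{px}\rangle$ on $X\times X^{\lozenge}$; $r(x,x^{\lozenge}):=(x^{\lozenge},x)$. The indicator $\iota_A$ equals $0$ on $A$ and $\infty$ off $A$. $\{h\le\pi_p\}:=\{(x,x^{\lozenge}):h(x,x^{\lozenge})\le\pi_p(x,x^{\lozenge})\}$. The $p$-Fenchel conjugate $h_p^{\lozenge}:X^{\lozenge}\times X\to[-\infty,\infty]$ is $$h_p^{\lozenge}(x^{\lozenge},x)=\sup_{(y,y^{\lozenge})\in X\times X^{\lozenge}}\{\langle x^{\lozenge},\overrightarrow{py}\rangle+\langle y^{\lozenge},\overrightarrow{px}\rangle-h(y,y^{\lozenge})\}.$$ $\Gamma_p^{\lozenge}(X):=\{h\in\Gamma(X\times X^{\lozenge}): h=(h+\iota_{\{h\le\pi_p\}})_p^{\lozenge}\circ r\text{ on }X\times X^{\lozenge}\}$. For a set-valued operator $T:X\multimap X^{\lozenge}$ (a map assigning to each $x\in X$ a possibly empty subset $T(x)\subseteq X^{\lozenge}$), $\mathrm{gra}(T)=\{(x,x^{\lozenge}):x^{\lozenge}\in T(x)\}$ and $\mathrm{Range}(T)=\mathrm{Range}(\mathrm{gra}(T))$. $T$ is monotone if $\langle x^{\lozenge}-y^{\lozenge},\overrightarrow{yx}\rangle\ge0$ for all $(x,x^{\lozenge}),(y,y^{\lozenge})\in\mathrm{gra}(T)$;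 it is maximal monotone if it is monotone and no monotone operator has a graph properly containing $\mathrm{gra}(T)$. *)

(* Defs.v *)
From HB Require Import structures.
From mathcomp Require Import all_boot all_order all_algebra.
From mathcomp Require Import ring lra.
From mathcomp Require Import all_classical all_reals all_analysis.

Set Implicit Arguments.
Unset Strict Implicit.
Unset Printing Implicit Defensive.

Import Order.TTheory GRing.Theory Num.Theory.
Import numFieldNormedType.Exports.

Local Open Scope classical_set_scope.
Local Open Scope ring_scope.

(* The norm of the library on 'rV_2 is the sup norm, not the Euclidean one. *)
Definition eucl_dist (R : realType) (u v : 'rV[R]_2) : R :=
  Num.sqrt (\sum_i (u 0 i - v 0 i) ^+ 2).

(* Only the values of c on [0, 1] matter. *)
Definition is_geodesic (R : realType) (X : metricType R) (x y : X)
    (c : R -> X) : Prop :=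
  [/\ c 0 = x, c 1 = y &
      {in `[0, 1] &, forall s t, mdist (c s) (c t) = `|s - t| * mdist x y}].

Definition comparison_triangle (R : realType) (X : metricType R) (x y z : X)
    (x' y' z' : 'rV[R]_2) : Prop :=
  [/\ eucl_dist x' y' = mdist x y, eucl_dist x' z' = mdist x z &
      eucl_dist y' z' = mdist y z].

(* Any two distinct sides of a triangle share a vertex, so it is enough to
   compare points of two sides issuing from the vertex x, for all triples. *)
HB.mixin Record Metric_isCAT0 (R : realType) X & Metric R X := {
  cat0_geodesic : forall x y : X, exists c : R -> X, is_geodesic x y c ;
  cat0_comparison : forall (x y z : X) (c1 c2 : R -> X) (x' y' z' : 'rV[R]_2),
    is_geodesic x y c1 -> is_geodesic x z c2 ->
    comparison_triangle x y z x' y' z' ->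
    {in `[0, 1] &, forall s t,
      mdist (c1 s) (c2 t) <=
      eucl_dist ((1 - s) *: x' + s *: y') ((1 - t) *: x' + t *: z')}
}.

#[short(type="hadamardType")]
HB.structure Definition Hadamard (R : realType) :=
  { X of Metric R X & Complete X & Pointed X & Metric_isCAT0 R X }.

Lemma eucl_dist_sqr (R : realType) (u v : 'rV[R]_2) :
  eucl_dist u v ^+ 2 = \sum_i (u 0 i - v 0 i) ^+ 2.
Proof. by rewrite sqr_sqrtr// sumr_ge0// => i _; rewrite sqr_ge0. Qed.

Lemma eucl_dist_ge0 (R : realType) (u v : 'rV[R]_2) : 0 <= eucl_dist u v.
Proof. exact: sqrtr_ge0. Qed.

Lemma comparison_triangle_exists (R : realType) (X : metricType R)
    (x y z : X) : exists x' y' z', comparison_triangle x y z x' y' z'.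
Proof.
pose vec (a b : R) : 'rV[R]_2 := \row_i (if i == 0 then a else b).
have dvec a b c d e : 0 <= e -> (a - c) ^+ 2 + (b - d) ^+ 2 = e ^+ 2 ->
    eucl_dist (vec a b) (vec c d) = e.
  move=> e0 h; apply/eqP; rewrite -(eqrXn2 (n := 2))// ?eucl_dist_ge0//.
  by rewrite eucl_dist_sqr big_ord_recl big_ord1 !mxE/= h.
have a0 := mdist_ge0 x y; have b0 := mdist_ge0 x z; have c0 := mdist_ge0 y z.
have := metric_triangle y x z; have := metric_triangle x y z.
have := metric_triangle x z y; rewrite (metric_sym y x) (metric_sym z y).
move: a0 b0 c0; set a := mdist x y; set b := mdist x z; set c := mdist y z.
move=> a0 b0 c0 h1 h2 h3.
have [aE|ane] := eqVneq a 0.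
  exists (vec 0 0), (vec 0 0), (vec b 0).
  split; apply: dvec => //; rewrite -/a -/b -/c.
  - by rewrite aE; ring.
  - by ring.
  - have -> : c = b by lra.
    by ring.
have ap : 0 < a by rewrite lt_neqAle eq_sym ane.
pose u := (a ^+ 2 + b ^+ 2 - c ^+ 2) / (2 * a).
have uE : 2 * a * u = a ^+ 2 + b ^+ 2 - c ^+ 2.
  by rewrite /u; field.
have ub : u ^+ 2 <= b ^+ 2.
  have hu1 : u <= b.
    rewrite -(ler_pM2l (x := 2 * a)) ?mulr_gt0// uE; nra.
  have hu2 : - b <= u.
    rewrite -(ler_pM2l (x := 2 * a)) ?mulr_gt0// uE; nra.
  nra.
exists (vec 0 0), (vec a 0), (vec u (Num.sqrt (b ^+ 2 - u ^+ 2))).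
have rE : Num.sqrt (b ^+ 2 - u ^+ 2) ^+ 2 = b ^+ 2 - u ^+ 2.
  by rewrite sqr_sqrtr// subr_ge0.
split; apply: dvec => //; rewrite -/a -/b -/c; first by ring.
  by rewrite !sub0r !sqrrN rE; ring.
by rewrite sub0r sqrrN rE; lra.
Qed.

Section hadamard.
Context {R : realType} {X : hadamardType R}.
Implicit Types x y z : X.

Lemma cat0_CN x y z (c : R -> X) s : is_geodesic x y c -> s \in `[0, 1] ->
  mdist (c s) z ^+ 2 <= (1 - s) * mdist x z ^+ 2 + s * mdist y z ^+ 2
                        - s * (1 - s) * mdist x y ^+ 2.
Proof.
move=> cg s01; have [c2 c2g] := cat0_geodesic x z.
have [x' [y' [z' tri]]] := comparison_triangle_exists x y z.
have i1 : (1 : R) \in `[0, 1] by rewrite in_itv/= ler01 lexx.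
have := cat0_comparison _ _ _ _ _ _ _ _ cg c2g tri s 1 s01 i1.
have [_ -> _] := c2g; have [<- <- <-] := tri => h.
have {}h : mdist (c s) z ^+ 2 <=
    eucl_dist ((1 - s) *: x' + s *: y') ((1 - 1) *: x' + 1 *: z') ^+ 2.
  by rewrite lerXn2r// nnegrE ?mdist_ge0 ?eucl_dist_ge0.
apply: le_trans h _; rewrite !eucl_dist_sqr !big_ord_recl !big_ord0 !mxE.
by rewrite le_eqVlt; apply/orP; left; apply/eqP; ring.
Qed.

(* geod x y t is the point written (1-t)x (+) ty. *)
Definition geod x y : R -> X := sval (cid (cat0_geodesic x y)).

Lemma geodP x y : is_geodesic x y (geod x y).
Proof. by rewrite /geod; case: cid. Qed.

Lemma geod_unique x y (c : R -> X) : is_geodesic x y c ->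
  {in `[0, 1], c =1 geod x y}.
Proof.
move=> cg s s01; apply: (@mdist_positivity R).
have := cat0_CN (geod x y s) cg s01.
have [g0 g1 gd] := geodP x y.
have i0 : (0 : R) \in `[0, 1] by rewrite in_itv/= lexx ler01.
have i1 : (1 : R) \in `[0, 1] by rewrite in_itv/= ler01 lexx.
have := gd _ _ i0 s01; rewrite g0 => ->.
have := gd _ _ i1 s01; rewrite g1 => ->.
rewrite !exprMn !real_normK ?num_real// => h.
apply/eqP; rewrite -sqrf_eq0 eq_le sqr_ge0 andbT; apply: le_trans h _.
by rewrite le_eqVlt; apply/orP; left; apply/eqP; ring.
Qed.

(* ql a b x y is the pairing of the vectors ab and xy. *)
Definition ql (a b x y : X) : R :=
  (mdist a y ^+ 2 + mdist b x ^+ 2 - mdist a x ^+ 2 - mdist b y ^+ 2) / 2.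

Lemma quadrilateral a b x y :
  mdist a y ^+ 2 + mdist b x ^+ 2 <=
  mdist a x ^+ 2 + mdist b y ^+ 2 + 2 * mdist a b * mdist x y.
Proof.
have [->|ab] := eqVneq a b.
  by rewrite mdistxx; lra.
have [->|xy] := eqVneq x y.
  by rewrite mdistxx; lra.
move: ab xy; rewrite -!(mdist_gt0 (R := R)) => P0 Q0.
set P := mdist a b; set Q := mdist x y; rewrite -/P -/Q in P0 Q0.
have [t tE] : exists t, t = P / (P + Q) by eexists.
have S0 : 0 < P + Q by rewrite addr_gt0.
have S0' : P + Q != 0 by rewrite gt_eqF.
have t0 : 0 <= t by rewrite tE divr_ge0 ?ltW.
have t1 : t <= 1 by rewrite tE ler_pdivrMr// mul1r lerDl ltW.
have it : t \in `[0, 1] by rewrite in_itv/= t0 t1.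
have h1 := cat0_CN (geod b x t) (geodP a y) it.
have h2 := cat0_CN a (geodP b x) it.
have h3 := cat0_CN y (geodP b x) it.
have := le_trans (sqr_ge0 _) h1.
rewrite (metric_sym a (geod b x _)) (metric_sym y (geod b x _)).
rewrite (metric_sym b a) (metric_sym x a) -/P -/Q in h2 h3 *.
move: h2 h3; set A := mdist (geod _ _ _) a; set B := mdist (geod _ _ _) y.
set d1 := mdist a y; set d2 := mdist b x; set e1 := mdist a x.
set e2 := mdist b y => h2 h3 h.
have t1' : 0 <= 1 - t by rewrite subr_ge0.
have {}h2 := ler_wpM2l t1' h2; have {}h3 := ler_wpM2l t0 h3.
have k : t * (1 - t) * (d1 ^+ 2 + d2 ^+ 2) <=
   t * (1 - t) * (e1 ^+ 2 + e2 ^+ 2) + (1 - t) ^+ 2 * P ^+ 2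
   + t ^+ 2 * Q ^+ 2.
  by lra.
have tt : t * (1 - t) = P * Q / (P + Q) ^+ 2 by rewrite tE; field.
have tp : 0 < t * (1 - t).
  by rewrite tt divr_gt0 ?mulr_gt0 ?exprn_gt0.
rewrite -(ler_pM2l tp) (le_trans k)// le_eqVlt; apply/orP; left; apply/eqP.
by rewrite tE; field.
Qed.

Lemma ql_CS a b x y : `|ql a b x y| <= mdist a b * mdist x y.
Proof.
have := quadrilateral a b x y; have := quadrilateral b a x y.
by rewrite (metric_sym b a) ler_norml /ql => h1 h2; apply/andP; split; lra.
Qed.

End hadamard.

(* The classes [t ab] are identified with the functions they induce on X^2,
   and a function on X^2 is written in curried form. *)
Definition dual_space (R : realType) (X : hadamardType R) : set (X -> X -> R) :=
  [set f | exists (t : R) (a b : X), f = fun x y => t * ql a b x y].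

Definition ldual_pred (R : realType) (X : hadamardType R) :
    {pred (X -> X -> R^o)} :=
  mem [set f : X -> X -> R^o | exists (n : nat) (alpha : 'I_n -> R)
         (g : 'I_n -> X -> X -> R), (forall i, dual_space (g i)) /\
         f = fun x y => \sum_(i < n) alpha i * g i x y].

(* The linear dual: f x y is the value of f on the vector xy. *)
Record ldual (R : realType) (X : hadamardType R) := LDual {
  ldual_fun :> X -> X -> R^o ;
  ldual_funP : ldual_fun \in @ldual_pred R X }.

Section ldual_lmodule.
Context {R : realType} {X : hadamardType R}.

HB.instance Definition _ := [isSub for @ldual_fun R X].
HB.instance Definition _ := [Choice of ldual X by <:].

Lemma ldual_pred_submod_closed : submod_closed (@ldual_pred R X).
Proof.
split=> [|k f g].
  rewrite inE; exists 0, (fun=> 0), (fun _ _ _ => 0); split=> [[]//|].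
  by apply/funext => x; apply/funext => y; rewrite big_ord0.
rewrite !inE => -[n [al [u [uP fE]]]] [m [be [v [vP gE]]]].
exists (n + m)%N, (fun i => match fintype.split i with
  | inl j => k * al j | inr j => be j end),
  (fun i => match fintype.split i with inl j => u j | inr j => v j end); split.
  by move=> i; case: fintype.split.
apply/funext => x; apply/funext => y; rewrite big_split_ord/= fE gE.
congr (_ + _); last by apply: eq_bigr => i _; rewrite (unsplitK (inr _)).
have -> : (k *: (fun x y => \sum_(i < n) al i * u i x y : R^o)) x y =
          k * \sum_(i < n) al i * u i x y by [].
rewrite mulr_sumr; apply: eq_bigr => i _.
by rewrite (unsplitK (inl _)) mulrA.
Qed.

HB.instance Definition _ := GRing.isSubmodClosed.Build R (X -> X -> R^o)
  (@ldual_pred R X) ldual_pred_submod_closed.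
HB.instance Definition _ := [SubChoice_isSubLmodule of ldual X by <:].

Implicit Types (f g : ldual X) (x y a b : X).

Lemma lduale0 x y : (0 : ldual X) x y = 0. Proof. by []. Qed.

Lemma ldualeD f g x y : (f + g) x y = f x y + g x y. Proof. by []. Qed.

Lemma ldualeN f x y : (- f) x y = - f x y. Proof. by []. Qed.

Lemma ldualeZ k f x y : (k *: f) x y = k * f x y. Proof. by []. Qed.

Lemma ldual_ext f g : (forall x y, f x y = g x y) -> f = g.
Proof.
by move=> h; apply: val_inj; apply/funext => x; apply/funext => y; exact: h.
Qed.

Lemma ldual_ind_fun f (P : (X -> X -> R) -> Prop) :
  (forall t a b, P (fun x y => t * ql a b x y)) -> P (fun _ _ => 0) ->
  (forall u v, P u -> P v -> P (fun x y => u x y + v x y)) ->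
  (forall k u, P u -> P (fun x y => k * u x y)) -> P f.
Proof.
move=> Pg P0 PD PZ; case: f => f /=; rewrite inE => -[n [al [g [gP ->]]]].
elim: n al g gP => [|n ih] al g gP.
  rewrite [X in P X](_ : _ = fun _ _ => 0)//.
  by apply/funext => x; apply/funext => y; rewrite big_ord0.
rewrite [X in P X](_ : _ = fun x y => al ord0 * g ord0 x y +
   \sum_(i < n) al (lift ord0 i) * g (lift ord0 i) x y).
  apply: PD; last by apply: ih => i; exact: gP.
  by apply: PZ; have [t [a [b ->]]] := gP ord0; exact: Pg.
by apply/funext => x; apply/funext => y; rewrite big_ord_recl.
Qed.

Lemma ldual_chasles f x y z : f x z = f x y + f y z.
Proof.
pose P (u : X -> X -> R) := forall a b c, u a c = u a b + u b c.
suff: P f by apply.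
apply: (@ldual_ind_fun f P) => [t a b|||] u v.
- by move=> w; rewrite /ql; field.
- by move=> w; rewrite addr0.
- by move=> hu hv a b c; rewrite (hu a b c) (hv a b c); ring.
- by move=> hv a b c; rewrite (hv a b c) mulrDr.
Qed.

Lemma ldual_lipschitz f : exists2 L, 0 <= L &
  forall x y, `|f x y| <= L * mdist x y.
Proof.
pose P (u : X -> X -> R) := exists2 L, 0 <= L &
  forall x y, `|u x y| <= L * mdist x y.
apply: (@ldual_ind_fun f P) => [t a b||u v [L L0 hu] [M M0 hv]|k u [L L0 hu]].
- exists (`|t| * mdist a b); first by rewrite mulr_ge0// mdist_ge0.
  by move=> x y; rewrite normrM -mulrA ler_wpM2l// ql_CS.
- by exists 0 => // x y; rewrite normr0 mul0r.
- exists (L + M); first exact: addr_ge0.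
  by move=> x y; rewrite mulrDl (le_trans (ler_normD _ _))// lerD.
- exists (`|k| * L); first by rewrite mulr_ge0.
  by move=> x y; rewrite normrM -mulrA ler_wpM2l.
Qed.

Definition ldual_quotients f : set R :=
  [set r | exists a b c d : X, (a, c) <> (b, d) /\
     r = `|f a b - f c d| / (mdist a b + mdist c d)].

(* When X is a point, there is no quotient and the supremum is 0 by the
   convention sup set0 = 0. *)
Definition ldual_norm f : R := sup (ldual_quotients f).

Lemma ldual_quotients_ubound f : has_ubound (ldual_quotients f).
Proof.
have [L L0 hL] := ldual_lipschitz f.
exists L => _ [a [b [c [d [abcd ->]]]]].
have [->|s0] := eqVneq (mdist a b + mdist c d) 0; first by rewrite invr0 mulr0.
rewrite ler_pdivrMr; last by rewrite lt_neqAle eq_sym s0 addr_ge0// mdist_ge0.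
by rewrite mulrDr (le_trans (ler_normB _ _))// lerD.
Qed.

Lemma ldual_norm_ub f a b c d :
  `|f a b - f c d| <= ldual_norm f * (mdist a b + mdist c d).
Proof.
have [[<- <-]|ne] := pselect ((a, c) = (b, d)).
  have ff x : f x x = 0 by have := ldual_chasles f x x x; lra.
  by rewrite !ff subrr normr0 !mdistxx addr0 mulr0.
have s0 : 0 < mdist a b + mdist c d.
  rewrite lt_neqAle eq_sym addr_ge0 ?mdist_ge0// andbT paddr_eq0 ?mdist_ge0//.
  apply/negP => /andP[/eqP/mdist_positivity ab /eqP/mdist_positivity cd].
  by apply: ne; rewrite ab cd.
rewrite -ler_pdivrMr//; apply: ub_le_sup; first exact: ldual_quotients_ubound.
by exists a, b, c, d.
Qed.

Lemma ldual_norm_ge0 f : 0 <= ldual_norm f.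
Proof.
have [[r fr]|/set0P/negP/negPn/eqP e] := pselect (ldual_quotients f !=set0);
  last by rewrite /ldual_norm e sup0.
apply: le_trans (ub_le_sup (ldual_quotients_ubound f) fr).
by have [a [b [c [d [_ ->]]]]] := fr; rewrite divr_ge0// addr_ge0// mdist_ge0.
Qed.

Lemma ldual_norm_le f M : 0 <= M ->
  (forall a b c d, `|f a b - f c d| <= M * (mdist a b + mdist c d)) ->
  ldual_norm f <= M.
Proof.
move=> M0 h; have [ne|/set0P/negP/negPn/eqP e] :=
  pselect (ldual_quotients f !=set0); last by rewrite /ldual_norm e sup0.
apply: ge_sup => // _ [a [b [c [d [_ ->]]]]].
have [->|s0] := eqVneq (mdist a b + mdist c d) 0; first by rewrite invr0 mulr0.
by rewrite ler_pdivrMr// lt_neqAle eq_sym s0 addr_ge0// mdist_ge0.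
Qed.

Lemma ldual_normD f g : ldual_norm (f + g) <= ldual_norm f + ldual_norm g.
Proof.
apply: ldual_norm_le => [|a b c d]; first by rewrite addr_ge0// ldual_norm_ge0.
rewrite !ldualeD mulrDl opprD addrACA (le_trans (ler_normD _ _))//.
by rewrite lerD// ldual_norm_ub.
Qed.

Lemma ldual_normZ_le k f : ldual_norm (k *: f) <= `|k| * ldual_norm f.
Proof.
apply: ldual_norm_le => [|a b c d]; first by rewrite mulr_ge0// ldual_norm_ge0.
by rewrite !ldualeZ -mulrBr normrM -mulrA ler_wpM2l// ldual_norm_ub.
Qed.

Lemma ldual_normZ k f : ldual_norm (k *: f) = `|k| * ldual_norm f.
Proof.
apply/eqP; rewrite eq_le ldual_normZ_le/=.
have [->|k0] := eqVneq k 0; first by rewrite normr0 mul0r ldual_norm_ge0.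
rewrite -ler_pdivlMl ?normr_gt0//.
by have := ldual_normZ_le k^-1 (k *: f); rewrite scalerK// normfV.
Qed.

Lemma ldual_norm_eq0 f : ldual_norm f = 0 -> f = 0.
Proof.
move=> f0; apply: ldual_ext => x y.
have ff : f x x = 0 by have := ldual_chasles f x x x; lra.
have := ldual_norm_ub f x y x x; rewrite f0 mul0r ff subr0 normr_le0.
by move/eqP.
Qed.

End ldual_lmodule.

HB.instance Definition _ (R : realType) (X : hadamardType R) :=
  Lmodule_isNormed.Build R (ldual X) (@ldual_normD R X) (@ldual_normZ R X)
    (@ldual_norm_eq0 R X).

Lemma ldual_normE (R : realType) (X : hadamardType R) (f : ldual X) :
  `|f| = sup [set r | exists a b c d : X, (a, c) <> (b, d) /\
                r = `|f a b - f c d| / (mdist a b + mdist c d)].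
Proof. by []. Qed.

Section operators.
Context {R : realType} {X : hadamardType R}.
Implicit Types (p : X) (M : set (X * ldual X)) (h : X * ldual X -> \bar R).
Implicit Types (T : X -> set (ldual X)).

Definition Dom M : set X := fst @` M.
Definition Range M : set (ldual X) := snd @` M.

Definition Fl_property p M : Prop :=
  forall (l : R) (f : ldual X) (x y : X), l \in `[0, 1] ->
    Range M f -> Dom M x -> Dom M y ->
    f p (geod x y l) <= (1 - l) * f p x + l * f p y.

Lemma Fl_property_indep p q M : Fl_property p M -> Fl_property q M.
Proof.
move=> h l f x y l01 fM xM yM; have := h l f x y l01 fM xM yM.
have e z : f q z = f q p + f p z := ldual_chasles f q p z.
rewrite (e (geod x y l)) (e x) (e y); lra.
Qed.

Definition proper_fun h : Prop :=
  (forall z, h z <> -oo%E) /\ (exists z, h z <> +oo%E).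

Definition lsc h : Prop :=
  closed [set w : (X * ldual X) * R | (h w.1 <= w.2%:E)%E].

(* In the library, 0 * +oo = 0 and +oo - oo = -oo; for a function without value
   -oo the inequalities below do not depend on these conventions. *)
Definition convex_fun h : Prop :=
  forall (x y : X) (f g : ldual X) (l : R), l \in `[0, 1] ->
    (h (geod x y l, ((1 - l) *: f + l *: g)%R) <=
     (1 - l)%:E * h (x, f) + l%:E * h (y, g))%E.

Definition Gamma : set (X * ldual X -> \bar R) :=
  [set h | [/\ proper_fun h, lsc h & convex_fun h]].

Definition coupling p (z : X * ldual X) : R := z.2 p z.1.

Definition indicator M (z : X * ldual X) : \bar R :=
  if z \in M then 0%E else +oo%E.

Definition below_coupling p h : set (X * ldual X) :=
  [set z | (h z <= (coupling p z)%:E)%E].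

Definition fenchel_conj p h (w : ldual X * X) : \bar R :=
  ereal_sup (range (fun z : X * ldual X =>
    ((w.1 p z.1 + z.2 p w.2)%:E - h z)%E)).

Definition Gamma_diamond p : set (X * ldual X -> \bar R) :=
  [set h | Gamma h /\
    forall z, h z =
      fenchel_conj p (fun y => h y + indicator (below_coupling p h) y)%E
        (swap_pair z)].

Definition gra T : set (X * ldual X) := [set z | T z.1 z.2].

Definition monotone T : Prop :=
  forall z w, gra T z -> gra T w -> 0 <= (z.2 - w.2) w.1 z.1.

Definition maximal_monotone T : Prop :=
  monotone T /\ forall T', monotone T' -> ~ (gra T `<` gra T').

Definition S_op h p : X -> set (ldual X) :=
  fun x => [set f | h (x, f) = (coupling p (x, f))%:E].

End operators.

(* Main.v *)
(* The function h is the Fitzpatrick function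
     phi_T(x, x') = sup_{(y, y') in gra T} (x'(py) + y'(px) - y'(py)),
   for which phi_T - pi_p = sup_{(y, y') in gra T} - (x' - y')(yx); by maximality
   this is nonnegative and vanishes exactly on gra T. Convexity in x is the
   F_l-property. Conversely, if h is in Gamma_p, then evaluating the supremum
   that defines h at pairs of points of {h <= pi_p} shows that this set is
   monotone; since it contains gra T it equals gra T, so that h = phi_T. *)
Require Import Defs.
From mathcomp Require Import all_boot all_order all_algebra.
From mathcomp Require Import ring lra.
From mathcomp Require Import all_classical all_reals all_analysis.

Import Order.TTheory GRing.Theory Num.Theory.
Import numFieldNormedType.Exports.

Local Open Scope classical_set_scope.
Local Open Scope ring_scope.

(** * Continuity of the pairing in each variable *)

Section ldual_continuity.
Context {R : realType} {X : hadamardType R}.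
Implicit Types (f : ldual X) (x y : X).

Lemma ldual_diag f x : f x x = 0.
Proof. by have := ldual_chasles f x x x; lra. Qed.

Lemma ldual_antisym f x y : f x y = - f y x.
Proof. by have := ldual_chasles f x y x; rewrite ldual_diag; lra. Qed.

Lemma ldual_le_norm f x y : `|f x y| <= `|f| * mdist x y.
Proof.
by have := ldual_norm_ub f x y x x; rewrite ldual_diag mdistxx subr0 addr0.
Qed.

Lemma ldual_continuous f x : continuous (f x : X -> R).
Proof.
move=> y; apply/cvgrPdist_lt => e e0.
(* Adding 1 keeps the divisor positive when [f] is 0. *)
have L0 : 0 < `|f| + 1 by rewrite ltr_wpDl.
have : \forall z \near y, mdist y z < e / (`|f| + 1).
  apply/nbhs_ballP; exists (e / (`|f| + 1)); first by rewrite /= divr_gt0.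
  by move=> z; rewrite ballEmdist.
apply: filterS => z; rewrite ltr_pdivlMr// => h.
rewrite (ldual_chasles f x z y) (addrC (f x z)) addrK.
apply: le_lt_trans (ldual_le_norm _ _ _) _; rewrite metric_sym.
have := mdist_ge0 y z; nra.
Qed.

Lemma ldual_eval_continuous x y : continuous (fun f : ldual X => f x y : R).
Proof.
move=> f; apply/(@cvgrPdist_lt _ _ _ _ (nbhs_filter f)) => e e0.
have L0 : 0 < mdist x y + 1 by rewrite ltr_wpDl// mdist_ge0.
have : \forall g \near f, `|f - g| < e / (mdist x y + 1).
  by apply/nbhs_normP; exists (e / (mdist x y + 1)); [rewrite /= divr_gt0|].
apply: filterS => g; rewrite ltr_pdivlMr// => h.
have := ldual_le_norm (f - g) x y; rewrite ldualeD ldualeN => k.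
by apply: le_lt_trans k _; have := normr_ge0 (f - g); lra.
Qed.

End ldual_continuity.

(** * The Fitzpatrick function of a set of pairs *)

Section fitzpatrick.
Context {R : realType} {X : hadamardType R}.
Implicit Types (p : X) (T : X -> set (ldual X)) (z w : X * ldual X).
Implicit Types (h : X * ldual X -> \bar R) (M : set (X * ldual X)).

Definition fitz_term p z w : R := z.2 p w.1 + w.2 p z.1 - coupling p w.

Definition fitzpatrick p M z : \bar R :=
  ereal_sup [set (fitz_term p z w)%:E | w in M].

(** Chasles' relation through [w.1]. It turns comparisons with [coupling p z] into monotonicity
    inequalities between [z] and [w]. *)
Lemma fitz_term_coupling p z w :
  fitz_term p z w = coupling p z - (z.2 - w.2) w.1 z.1.
Proof.
rewrite /fitz_term /coupling ldualeD ldualeN.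
rewrite (ldual_chasles z.2 p w.1 z.1) (ldual_chasles w.2 p w.1 z.1); ring.
Qed.

Lemma fitzpatrick_ub p M z w : M w ->
  ((fitz_term p z w)%:E <= fitzpatrick p M z)%E.
Proof. by move=> Mw; apply: ereal_sup_ubound; exists w. Qed.

Lemma fitzpatrick_le p M z (c : \bar R) :
  (forall w, M w -> ((fitz_term p z w)%:E <= c)%E) -> (fitzpatrick p M z <= c)%E.
Proof. by move=> H; apply: ge_ereal_sup => _ [w Mw <-]; exact: H. Qed.

Lemma fenchel_conj_indicator p h M : (forall z, h z <> -oo%E) ->
  {in M, forall z, h z = (coupling p z)%:E} -> forall z,
  fenchel_conj p (fun y => h y + indicator M y)%E (swap_pair z) =
  fitzpatrick p M z.
Proof.
move=> hN hM z; apply/eqP; rewrite eq_le; apply/andP; split.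
  apply: ge_ereal_sup => _ [w _ <-] /=; rewrite /indicator.
  case: ifPn => [wM|_].
    by rewrite adde0 hM// -EFinB; apply: fitzpatrick_ub; exact: set_mem.
  (* Off [M] the term of the supremum is -oo. [hN] excludes the sum -oo + oo, which would be -oo by
     convention. *)
  by rewrite addey ?leNye//; apply/eqP; exact: hN.
apply: fitzpatrick_le => w Mw; apply: ereal_sup_ubound; exists w => //=.
by rewrite /indicator mem_set// adde0 hM ?mem_set// -EFinB.
Qed.

(** The epigraph is an intersection of closed sets, because each [fitz_term p z w] is a function of
    [z.2] plus one of [z.1], both continuous. *)
Lemma fitzpatrick_lsc p M : lsc (fitzpatrick p M).
Proof.
rewrite /lsc (_ : [set _ | _] = \bigcap_(w in M)
    [set u | fitz_term p u.1 w - u.2 <= 0]); last first.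
  apply/seteqP; split => [u /= hu w Mw /=|u hu /=].
    by rewrite subr_le0 -lee_fin (le_trans _ hu)// fitzpatrick_ub.
  by apply: fitzpatrick_le => w Mw; rewrite lee_fin -subr_le0; exact: hu.
apply: closed_bigI => w _.
suff c : continuous (fun u : (X * ldual X) * R => fitz_term p u.1 w - u.2 : R).
  by apply: (preimage_closed _ (@closed_le R 0)) => u _; exact: c.
move=> u; rewrite /fitz_term.
have c11 : {for u, continuous (fun u : (X * ldual X) * R => u.1.1)}.
  by apply: (@continuous_comp _ _ _ fst fst); exact: cvg_fst.
have c12 : {for u, continuous (fun u : (X * ldual X) * R => u.1.2)}.
  by apply: (@continuous_comp _ _ _ fst snd); [exact: cvg_fst|exact: cvg_snd].
apply: cvgB; last exact: cvg_snd.
apply: cvgB; last exact: cvg_cst.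
apply: cvgD.
  exact: (continuous_comp c12 (@ldual_eval_continuous _ _ p w.1 _)).
exact: (continuous_comp c11 (@ldual_continuous _ _ w.2 p _)).
Qed.

(** For fixed [w], the term is affine in [z.2] and convex along geodesics in [z.1] by the
    F_l-property; suprema preserve this. *)
Lemma fitzpatrick_convex p M : Fl_property p ([set: X] `*` Range M) ->
  convex_fun (fitzpatrick p M).
Proof.
move=> Fl x y f g l l01; apply: fitzpatrick_le => -[v v'] Mv.
have /andP[l0 l1] : (0 <= l) && (l <= 1) by move: l01; rewrite in_itv.
have rv : Range M v' by exists (v, v').
(* The product projects onto all of X because [v'] witnesses that its second factor is nonempty. *)
have dM u : Dom ([set: X] `*` Range M) u by exists (u, v').
have rM : Range ([set: X] `*` Range M) v' by exists (p, v').
have k := Fl l v' x y l01 rM (dM x) (dM y).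
have l1' : 0 <= 1 - l by rewrite subr_ge0.
have hx := lee_wpmul2l (x := (1 - l)%:E) l1' (fitzpatrick_ub p M (x, f) _ Mv).
have hy := lee_wpmul2l (x := l%:E) l0 (fitzpatrick_ub p M (y, g) _ Mv).
apply: le_trans (leeD hx hy); rewrite -!EFinM -EFinD lee_fin.
rewrite /fitz_term /coupling [_ p (v, v').1]ldualeD !ldualeZ/=; lra.
Qed.

(** * Maximality and the set where the Fitzpatrick function is below the coupling *)

Definition operator_of M : X -> set (ldual X) := fun x => [set f | M (x, f)].

Lemma gra_operator_of M : gra (operator_of M) = M.
Proof. by apply/seteqP; split=> -[]. Qed.

Lemma monotone_pairE z w : (z.2 - w.2) w.1 z.1 = (w.2 - z.2) z.1 w.1.
Proof. by rewrite ldual_antisym -ldualeN opprB. Qed.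

Lemma maximal_monotone_sub T M : maximal_monotone T -> gra T `<=` M ->
  Defs.monotone (operator_of M) -> M = gra T.
Proof.
move=> [_ Tmax] TM Mmon; apply/seteqP; split => //; apply/not_notP => MT.
by apply: (Tmax _ Mmon); rewrite gra_operator_of; split.
Qed.

(** Adjoining [z] to the graph keeps it monotone, so by maximality [z] was already there. *)
Lemma maximal_monotone_mem T z : maximal_monotone T ->
  (forall w, gra T w -> 0 <= (z.2 - w.2) w.1 z.1) -> gra T z.
Proof.
move=> Tmax zT.
suff mon : Defs.monotone (operator_of (gra T `|` [set z])).
  rewrite -(maximal_monotone_sub _ _ Tmax _ mon); first by right.
  by move=> w; left.
have zz u : 0 <= (z.2 - z.2) u z.1 by rewrite subrr lduale0.
move=> u w; rewrite gra_operator_of => -[Tu|->] [Tw|->].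
- exact: Tmax.1.
- by rewrite monotone_pairE; exact: zT.
- exact: zT.
- exact: zz.
Qed.

Lemma maximal_monotone_nonempty T : maximal_monotone T -> gra T !=set0.
Proof.
move=> Tmax; apply/set0P/negP => /eqP T0.
(* Over an empty graph the condition on [w] is vacuous, so any pair would belong to it. *)
have : gra T (point, 0) by apply: maximal_monotone_mem => // w; rewrite T0.
by rewrite T0.
Qed.

(** Monotonicity bounds every term by the coupling, and the term [w = z] attains it. *)
Lemma fitzpatrick_gra p T z : Defs.monotone T -> gra T z ->
  fitzpatrick p (gra T) z = (coupling p z)%:E.
Proof.
move=> Tmon Tz; apply/eqP; rewrite eq_le; apply/andP; split.
  apply: fitzpatrick_le => w Tw.
  by rewrite lee_fin fitz_term_coupling lerBlDr lerDl; exact: Tmon.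
apply: le_trans (fitzpatrick_ub p (gra T) z z Tz).
by rewrite fitz_term_coupling ldual_diag subr0.
Qed.

Lemma fitzpatrick_below p T : maximal_monotone T ->
  below_coupling p (fitzpatrick p (gra T)) = gra T.
Proof.
move=> Tmax; apply/seteqP; split => z /=; last first.
  by move=> Tz; rewrite /below_coupling/= fitzpatrick_gra//; exact: Tmax.1.
move=> hz; apply: maximal_monotone_mem => // w Tw.
have := le_trans (fitzpatrick_ub p (gra T) z w Tw) hz.
by rewrite lee_fin fitz_term_coupling lerBlDr lerDl.
Qed.

Lemma S_op_fitzpatrick p T : maximal_monotone T ->
  S_op (fitzpatrick p (gra T)) p = T.
Proof.
move=> Tmax; apply/funext => x; apply/seteqP; split => f /=.
  move=> e; rewrite -[T x f]/(gra T (x, f)) -(fitzpatrick_below p T Tmax).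
  by rewrite /below_coupling/= e.
by move=> Tf; apply: fitzpatrick_gra => //; exact: Tmax.1.
Qed.

Lemma fitzpatrick_Gamma p T : maximal_monotone T ->
  Fl_property p ([set: X] `*` Range (gra T)) ->
  Gamma_diamond p (fitzpatrick p (gra T)).
Proof.
(* A point of the graph keeps the supremum away from -oo and gives a finite value. *)
move=> Tmax Fl; have [z0 Tz0] := maximal_monotone_nonempty T Tmax.
have hN z : fitzpatrick p (gra T) z <> -oo%E.
  by move=> e; have := fitzpatrick_ub p (gra T) z z0 Tz0; rewrite e.
split.
  split; [split=> //|exact: fitzpatrick_lsc|exact: fitzpatrick_convex].
  by exists z0; rewrite fitzpatrick_gra//; exact: Tmax.1.
move=> z; rewrite fitzpatrick_below// fenchel_conj_indicator// => w.
by rewrite inE => Tw; apply: fitzpatrick_gra => //; exact: Tmax.1.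
Qed.

Lemma Gamma_diamond_below_monotone p h : Gamma_diamond p h ->
  Defs.monotone (operator_of (below_coupling p h)).
Proof.
move=> [[[hN _] _ _] hE] z w; rewrite gra_operator_of => hz hw.
have : ((z.2 p w.1 + w.2 p z.1)%:E - h w <= h z)%E.
  (* [hw] makes the indicator vanish at [w], so [w] contributes a genuine term to [h z]. *)
  rewrite [leRHS]hE; apply: ereal_sup_ubound; exists w => //=.
  by rewrite /indicator mem_set// adde0.
move: hz hw; rewrite /below_coupling/=; have := hN z; have := hN w.
(* Both values are real: [hN] excludes -oo, and lying below the coupling excludes +oo. *)
case: (h z) => [a||]//; case: (h w) => [b||]// _ _.
rewrite -EFinB !lee_fin => hz hw k.
have : fitz_term p z w <= coupling p z by rewrite /fitz_term; lra.
by rewrite fitz_term_coupling lerBlDr lerDl.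
Qed.

Lemma Gamma_diamond_fitzpatrick p T h : maximal_monotone T ->
  Gamma_diamond p h -> T = S_op h p -> h = fitzpatrick p (gra T).
Proof.
move=> Tmax Gh TE.
have hT z : gra T z -> h z = (coupling p z)%:E by case: z => x f; rewrite TE.
have bT : below_coupling p h = gra T.
  (* Maximality turns the inclusion of [gra T] in a monotone set into equality. *)
  apply: maximal_monotone_sub => //; last exact: Gamma_diamond_below_monotone.
  by move=> z Tz; rewrite /below_coupling/= hT.
apply/funext => z; case: Gh => -[[hN _] _ _] ->.
by rewrite bT fenchel_conj_indicator// => w; rewrite inE; exact: hT.
Qed.

End fitzpatrick.

Theorem theorem5p15 (R : realType) (X : hadamardType R) (p : X)
    (T : X -> set (ldual X)) (T_max : maximal_monotone T)
    (T_Fl : Fl_property p ([set: X] `*` Range (gra T))) :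
  exists! h : X * ldual X -> \bar R,
    Gamma_diamond p h /\ T = S_op h p.
Proof.
exists (fitzpatrick p (gra T)); split.
  by rewrite S_op_fitzpatrick//; split=> //; exact: fitzpatrick_Gamma.
by move=> h [Gh TE]; rewrite -(Gamma_diamond_fitzpatrick _ _ _ T_max Gh TE).
Qed.
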